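(* Let $X$ be a compact metric space and $T:X\to X$ a homeomorphism such that the $\mathbb{Z}$-system $(X,T)$ is minimal and tame. Then the topological entropy $h_{\rm top}(X,T)$ is zero.
   Context: The enveloping semigroup $E(X,T)$ is the pointwise closure in $X^X$ of $\{T^n:n\in\mathbb{Z}\}$. A space is Fréchet if every point in the closure of a set $A$ is a limit of a sequence from $A$. The system is tame if $E(X,T)$ is separable and Fréchet. Minimal: every orbit is dense. *)

(* Defs.v *)
From HB Require Import structures.
From mathcomp Require Import all_boot all_order all_algebra.
From mathcomp Require Import all_classical all_reals all_analysis.
Set Implicit Arguments. Unset Strict Implicit. Unset Printing Implicit Defensive.
Import Order.TTheory GRing.Theory Num.Theory.
Local Open Scope classical_set_scope.
Local Open Scope ring_scope.

Section Dyn.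
Context {R : realType} {X : metricType R}.

Definition is_homeomorphism (T Ti : X -> X) : Prop :=
  [/\ cancel T Ti, cancel Ti T, continuous T & continuous Ti].

Definition zpow (T Ti : X -> X) (n : int) : X -> X :=
  match n with
  | Posz k => iter k T
  | Negz k => iter k.+1 Ti
  end.

Definition minimal_system (T Ti : X -> X) : Prop :=
  forall x : X, closure (range (fun n : int => zpow T Ti n x)) = [set: X].

Definition enveloping_semigroup (T Ti : X -> X) : set {ptws X -> X} :=
  closure (range (fun n : int => (zpow T Ti n : {ptws X -> X}))).

Definition separable_subspace {Y : topologicalType} (A : set Y) : Prop :=
  exists D : set Y, [/\ D `<=` A, countable D & A `<=` closure D].

Definition frechet_subspace {Y : topologicalType} (A : set Y) : Prop :=
  forall B : set Y, B `<=` A -> forall y : Y, A y -> closure B y ->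
    exists u : nat -> Y, (forall n, B (u n)) /\ (u @ \oo --> y).

Definition tame_system (T Ti : X -> X) : Prop :=
  separable_subspace (enveloping_semigroup T Ti) /\
  frechet_subspace (enveloping_semigroup T Ti).

Definition bowen_dist (T : X -> X) (n : nat) (x y : X) : R :=
  \big[Num.max/0]_(k < n) mdist (iter k T x) (iter k T y).

Definition separated_seq (T : X -> X) (n : nat) (eps : R) (s : seq X) : Prop :=
  uniq s /\ {in s &, forall x y, x != y -> eps < bowen_dist T n x y}.

Definition sep_num (T : X -> X) (n : nat) (eps : R) : \bar R :=
  ereal_sup [set ((size s)%:R)%:E | s in separated_seq T n eps].

Definition sep_growth (T : X -> X) (eps : R) : \bar R :=
  limn_esup (fun n : nat =>
    match sep_num T n eps with
    | EFin r => (ln r / n%:R)%:E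
    | _ => +oo%E
    end).

Definition topological_entropy (T : X -> X) : \bar R :=
  ereal_sup [set sep_growth T eps | eps in [set e : R | 0 < e]].

End Dyn.

(* Main.v *)
Require Import Defs.
From HB Require Import structures.
From mathcomp Require Import all_boot all_order all_algebra.
From mathcomp Require Import zify lra.
Set Implicit Arguments. Unset Strict Implicit. Unset Printing Implicit Defensive.
Import Order.TTheory GRing.Theory Num.Theory.
Local Open Scope ring_scope.

(** If the entropy at scale [e] is positive, then for infinitely many [n] there
    are exponentially many [(n, e)]-separated points. Recording which points of
    the orbits are near to or far from the points of a finite net turns them
    into partial [{0, 1}]-valued functions on [n * r] coordinates, pairwise
    conflicting at some coordinate. Splitting such a family along balanced
    coordinates shows that it shatters exponentially many sets of coordinates,
    hence one of size proportional to [n]. A density argument and compactness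
    then give an infinite set [J] of times and two disjoint closed sets [A 0],
    [A 1] such that every [s : J -> {0, 1}] is the itinerary of a point:
    [T^j x] lies in [A (s j)] for all [j] in [J].

    This contradicts the Frechet property. A cluster point [p] of the [T^j],
    [j] in [J], is a limit of a sequence [T^(j_n)] with [j_n] in [J]. If the
    [j_n] are unbounded, a colouring [s] that takes both values infinitely often
    along them puts [p x] in both [A 0] and [A 1]. If they are bounded by [m],
    the colouring [i <= m] does, since [p] is a cluster point of the [T^j] with
    [j > m] too. *)

(** * Counting small subsets of a finite set *)

Lemma sum_exprn_card (R : comNzRingType) (Z : finType) (x : R) :
  \sum_(W : {set Z}) x ^+ #|W| = (x + 1) ^+ #|Z|.
Proof.
transitivity (\prod_(z in Z) (x + 1)); last by rewrite prodr_const.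
rewrite (eq_bigl xpredT) // bigA_distr /=; apply: eq_bigr => W _.
by rewrite -big_mkcond prodr_const.
Qed.

Lemma bernoulli (R : realDomainType) (x : R) (n : nat) :
  0 <= x -> 1 + n%:R * x <= (1 + x) ^+ n.
Proof.
move=> x0; elim: n => [|n IH]; first by rewrite mul0r addr0.
rewrite exprS mulrDl mul1r -natr1 mulrDl mul1r addrA lerD //.
apply: ler_peMr => //; apply: le_trans IH.
by rewrite lerDl mulr_ge0.
Qed.

Definition num_small (Z : finType) (d : nat) : nat :=
  #|[set W : {set Z} | (#|W| <= d)%N]|.

(** In the generating function of subset sizes, each set with at most [d] elements has weight at
    least [x ^+ d], because [x <= 1]. *)
Lemma num_small_le (R : realDomainType) (Z : finType) (d : nat) (x : R) :
  0 <= x <= 1 -> (num_small Z d)%:R * x ^+ d <= (1 + x) ^+ #|Z|.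
Proof.
move=> /andP[x0 x1]; rewrite addrC -sum_exprn_card.
rewrite (bigID (fun W : {set Z} => (#|W| <= d)%N)) /=.
rewrite mulr_natl -sumr_const.
apply: le_trans (lerD (lexx _) (sumr_ge0 _ _)); last first.
  by move=> W _; rewrite exprn_ge0.
rewrite addr0 [leLHS](eq_bigl (fun W : {set Z} => #|W| <= d)%N); last first.
  by move=> W; rewrite inE.
by apply: ler_sum => W Wd; rewrite ler_wiXn2l.
Qed.

Lemma num_small_subexponential (R : archiRealFieldType) (x : R) :
  0 < x <= 1 -> exists2 q : nat, (0 < q)%N & forall (Z : finType) (d : nat),
    (d * q <= #|Z|)%N -> (num_small Z d)%:R <= (1 + x) ^+ (2 * #|Z|).
Proof.
move=> /andP[x0 x1].
(* As [q] exceeds [x^-1 * x^-1], Bernoulli gives [(1 + x) ^+ q >= q%:R * x >= x^-1]. The [d]-th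
   power of this absorbs [x ^+ d] at a cost of at most [(1 + x) ^+ #|Z|]. *)
exists (Num.trunc (x^-1 * x^-1)).+1 => // Z d; set q := _.+1 => dq.
have xq : 1 <= x * (1 + x) ^+ q.
  rewrite -ler_pdivrMl // mulr1; apply: le_trans (bernoulli q (ltW x0)).
  apply: ler_wpDl => //; rewrite -ler_pdivrMr //.
  exact/ltW/truncnS_gt.
have x1_ge1 : 1 <= 1 + x by rewrite lerDl ltW.
have := @num_small_le R Z d x; rewrite ltW //= => /(_ x1) small.
rewrite mul2n -addnn exprD.
have : (1 + x) ^+ #|Z| * (1 + x) ^+ (d * q) <= (1 + x) ^+ #|Z| * (1 + x) ^+ #|Z|.
  by rewrite ler_wpM2l ?exprn_ge0 ?ler_weXn2l // (le_trans ler01).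
apply: le_trans.
apply: le_trans (ler_wpM2r _ small); last by rewrite exprn_ge0 // (le_trans ler01).
rewrite -mulrA ler_peMr // mulnC exprM -exprMn exprn_ege1 //.
Qed.

(** * Shattering by partial [{0, 1}]-valued functions *)

Section Shatter.
Context {I Z : finType} (a : I -> Z -> option bool).
Implicit Types (S : {set I}) (W : {set Z}).

(** Only the trace of [V] on [W] matters. [None] matches neither value, so the witnesses are defined
    on all of [W]. *)
Definition shatters S W : bool :=
  [forall V : {set Z}, exists i in S, forall z in W, a i z == Some (z \in V)].

Definition num_shattered S : nat := #|[set W | shatters S W]|.

Definition split_at S z b : {set I} := [set i in S | a i z == Some b].

Definition pairwise_separated S : Prop :=
  {in S &, forall i j, i != j ->
    exists z b, a i z = Some b /\ a j z = Some (~~ b)}.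

Lemma shattersP S W :
  reflect (forall V : {set Z}, exists2 i, i \in S &
             {in W, forall z, a i z = Some (z \in V)})
          (shatters S W).
Proof.
apply: (iffP forallP) => h V.
  have /existsP[i /andP[iS /forallP hi]] := h V.
  by exists i => // z zW; apply/eqP; move: (hi z); rewrite zW.
have [i iS hi] := h V.
apply/existsP; exists i; rewrite iS /=; apply/forallP => z.
by apply/implyP => /hi ->.
Qed.

Lemma shatters_split S z W :
  shatters (split_at S z false) W -> shatters (split_at S z true) W ->
  (z \notin W) && shatters S (z |: W).
Proof.
move=> /shattersP h0 /shattersP h1; apply/andP; split.
  apply/negP => zW.
  have [i] := h0 [set z]; rewrite inE => /andP[_ /eqP iz] /(_ _ zW).
  by rewrite iz inE eqxx.
apply/shattersP => V.
have [i] : exists2 i, i \in split_at S z (z \in V) &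
    {in W, forall z, a i z = Some (z \in V)} by case: (z \in V).
rewrite inE => /andP[iS /eqP iz] hi; exists i => // y.
by rewrite !inE => /orP[/eqP->|/hi].
Qed.

(** Each half is constant at [z], so it shatters no set containing [z]. A set [W] shattered by both
    halves is counted twice on the left, and [z |: W], shattered by [S] but by neither half, makes
    up for it. *)
Lemma num_shattered_split S z :
  (num_shattered (split_at S z false) + num_shattered (split_at S z true)
   <= num_shattered S)%N.
Proof.
rewrite /num_shattered.
set F0 := [set W | _]; set F1 := [set W | _]; set F := [set W | _].
have sub b : [set W | shatters (split_at S z b) W] \subset F.
  apply/subsetP => W; rewrite !inE => /shattersP h; apply/shattersP => V.
  by have [i] := h V; rewrite inE => /andP[iS _]; exists i.
rewrite -cardsUI.
have inj : {in F0 :&: F1 &, injective (fun W => z |: W)}.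
  move=> W W'; rewrite !inE => /andP[w0 w1] /andP[w0' w1'] e.
  have /andP[zW _] := shatters_split w0 w1.
  have /andP[zW' _] := shatters_split w0' w1'.
  by rewrite -(setU1K zW) e setU1K.
rewrite -(card_in_imset inj) -cardsUI.
rewrite (_ : _ :&: (imset _ _) = set0) ?cards0 ?addn0; last first.
  apply/setP => W; rewrite !inE; apply/negP => /andP[hW /imsetP[W']].
  rewrite !inE => _ e; move: hW; rewrite e.
  by case/orP => /shattersP h; [have [i] := h [set z] | have [i] := h set0];
     rewrite inE => /andP[_ /eqP iz] /(_ z); rewrite iz setU11 !inE ?eqxx => /(_ erefl).
apply/subset_leq_card; rewrite !subUset !sub /=.
apply/subsetP => _ /imsetP[W + ->]; rewrite !inE => /andP[h0 h1].
by have /andP[] := shatters_split h0 h1.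
Qed.

(* If no coordinate splits [S] evenly, most members of [S] take the minority
   value on a small set of coordinates only, and that set determines them. *)
Lemma balanced_split S q : (0 < q)%N ->
  pairwise_separated S -> (2 * num_small Z (#|Z| %/ q) < #|S|)%N ->
  exists z, forall b, (#|S| <= 2 * q * #|split_at S z b|)%N.
Proof.
move=> q0 sepS bigS; set d := (_ %/ _)%N in bigS.
case: (boolP [exists z, [forall b, (#|S| <= 2 * q * #|split_at S z b|)%N]]).
  by move=> /existsP[z /forallP h]; exists z.
move=> /existsPn nosplit.
have minority z : exists b, (2 * q * #|split_at S z b| < #|S|)%N.
  by have /forallPn[b] := nosplit z; rewrite -ltnNge; exists b.
pose m z := xchoose (minority z).
have mP z : (2 * q * #|split_at S z (m z)| < #|S|)%N by exact: (xchooseP (minority z)).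
pose M i := [set z | a i z == Some (m z)].
pose S0 := [set i in S | (#|M i| <= d)%N].
have S0small : (#|S0| <= num_small Z d)%N.
  rewrite -(card_in_imset (f := M)); last first.
    move=> i j; rewrite !inE => /andP[iS _] /andP[jS _] eM.
    apply/eqP/negPn/negP => /(sepS _ _ iS jS)[z [b [iz jz]]].
    have : (z \in M i) = (z \in M j) by rewrite eM.
    by rewrite !inE iz jz; case: b {iz jz}; case: (m z).
  apply/subset_leq_card/subsetP => _ /imsetP[i + ->].
  by rewrite !inE => /andP[].
have dbl : (\sum_(i in S) #|M i| = \sum_z #|split_at S z (m z)|)%N.
  under eq_bigr do rewrite -sum1_card.
  under [RHS]eq_bigr do rewrite -sum1_card.
  rewrite (exchange_big_dep xpredT) //=; apply: eq_bigr => z _.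
  by apply: eq_bigl => i; rewrite !inE.
have up : (2 * q * \sum_(i in S) #|M i| <= #|Z| * #|S|)%N.
  rewrite dbl big_distrr /= -sum_nat_const.
  by apply: leq_sum => z _; apply: ltnW.
have low : (d.+1 * (#|S| - #|S0|) <= \sum_(i in S) #|M i|)%N.
  rewrite (bigID (mem S0)) /=; apply: leq_trans (leq_addl _ _).
  rewrite (_ : #|S| - #|S0| = #|S :\: S0|)%N; last first.
    rewrite cardsD (setIidPr _) //.
    by apply/subsetP => i; rewrite inE => /andP[].
  rewrite mulnC -sum_nat_const; rewrite [leqRHS](eq_bigl (mem (S :\: S0))); last first.
    by move=> i; rewrite !inE andbC.
  by apply: leq_sum => i; rewrite !inE => /andP[+ iS]; rewrite iS -ltnNge.
(* More than half of [S] lies outside [S0], with over [d] minority coordinates each. So [2 * q]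
   times the sum exceeds [q * d.+1 * #|S|], hence [#|Z| * #|S|], against [up]. *)
have qd : (#|Z| < d.+1 * q)%N by rewrite /d -ltn_divLR.
move: up low qd S0small bigS; move: (\sum_(i in S) _)%N => s.
nia.
Qed.

(** Induction on [k]: a balanced split doubles the lower bound and costs a factor [2 * q] in
    size. *)
Lemma num_shattered_ge S q k : (0 < q)%N ->
  pairwise_separated S ->
  ((2 * q) ^ k * (2 * num_small Z (#|Z| %/ q)) < #|S|)%N ->
  (2 ^ k <= num_shattered S)%N.
Proof.
move=> q0; elim: k S => [|k IH] S sepS.
  rewrite mul1n => bigS; have /card_gt0P[i iS] : (0 < #|S|)%N by lia.
  apply/card_gt0P; exists set0; rewrite inE; apply/shattersP => V.
  by exists i => // z; rewrite inE.
rewrite expnS => bigS.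
have [z hz] : exists z, forall b, (#|S| <= 2 * q * #|split_at S z b|)%N.
  apply: balanced_split => //; apply: leq_ltn_trans bigS.
  by rewrite leq_pmull // muln_gt0 ?expn_gt0 muln_gt0 q0.
have half b : (2 ^ k <= num_shattered (split_at S z b))%N.
  apply: IH.
    by move=> i j; rewrite !inE => /andP[iS _] /andP[jS _]; apply: sepS.
  rewrite -(ltn_pmul2l (m := (2 * q)%N)) ?muln_gt0 ?q0 // mulnA.
  exact: leq_trans (hz b).
apply: leq_trans (num_shattered_split S z).
by rewrite expnS mul2n -addnn leq_add.
Qed.

End Shatter.

(** * Shattered sets of proportional size *)

Lemma root_approx (R : archiRealFieldType) (c : R) (m : nat) : 0 < c ->
  exists2 x : R, 0 < x <= 1 & (1 + x) ^+ m <= 1 + c.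
Proof.
(* The constant comes from [(1 + x) ^+ m <= 1 + 3 ^+ m * x] on [[0, 1]], proved by induction
   below. *)
move=> c0; exists (Num.min 1 (c / 3 ^+ m)).
  by rewrite lt_min ltr01 ge_min lexx divr_gt0 // exprn_gt0.
set x := Num.min _ _.
have x0 : 0 <= x by rewrite le_min ler01 divr_ge0 ?exprn_ge0 // ltW.
have x1 : x <= 1 by rewrite ge_min lexx.
have xc : 3 ^+ m * x <= c.
  by rewrite mulrC -ler_pdivlMr ?exprn_gt0 // ge_min lexx orbT.
suff : (1 + x) ^+ m <= 1 + 3 ^+ m * x by move=> /le_trans; apply; rewrite lerD2l.
clearbody x; elim: m {xc} => [|m IH]; first by rewrite expr0 mul1r lerDl.
rewrite exprS; apply: le_trans (ler_wpM2l _ IH) _; first by rewrite addr_ge0.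
have t1 : 1 <= 3 ^+ m :> R by rewrite exprn_ege1 // ler1n.
rewrite exprS; move: (3 ^+ m) t1 => t t1.
have : 0 <= (t - 1) * x by rewrite mulr_ge0 // subr_ge0.
have : 0 <= t * (x * (1 - x)) by rewrite !mulr_ge0 ?subr_ge0 // (le_trans ler01).
nra.
Qed.

(** Exponentially many sets are shattered, more than there are small sets of coordinates. So some
    shattered set fills a fixed fraction of the [n * r] coordinates, and one of the [r] columns
    carries at least the average share. *)
Lemma exists_linear_shattered (R : archiRealFieldType) (c : R) (r : nat) :
  0 < c -> (0 < r)%N ->
  exists q n0 : nat, (0 < q)%N /\
    forall (n : nat) (I : finType) (a : I -> 'I_n * 'I_r -> option bool)
           (S : {set I}),
      (n0 <= n)%N -> pairwise_separated a S -> (1 + c) ^+ n <= #|S|%:R ->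
      exists (j : 'I_r) (J : {set 'I_n}), (n <= q * #|J|)%N /\
        forall V : {set 'I_n}, exists2 i, i \in S &
          {in J, forall k, a i (k, j) = Some (k \in V)}.
Proof.
move=> c0 r0.
have [x /andP[x0 x1] xc] := @root_approx R c (4 * r) c0.
have [|q q0 small] := @num_small_subexponential R x; first by rewrite x0.
have gt1 y : 0 < y -> 1 < 1 + y :> R by rewrite ltrDl.
have [p p0 qp] : exists2 p, (0 < p)%N & (2 * q)%:R < (1 + x) ^+ p.
  exists (Num.trunc ((2 * q)%:R / x)).+1 => //.
  apply: lt_le_trans (bernoulli _ (ltW x0)).
  by apply: ltr_wpDl => //; rewrite -ltr_pdivrMr //; exact: truncnS_gt.
(* A second scale, fixed after [p]: it makes the small sets fewer than [2 ^ (n %/ p)]. *)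
have [y /andP[y0 y1] y2] := @root_approx R 1 (4 * r * p) ltr01.
have [|q' q'0 small'] := @num_small_subexponential R y; first by rewrite y0.
exists q', p; split=> // n I a S pn sepS bigS.
pose Z : finType := ('I_n * 'I_r)%type.
have cZ : #|Z| = (n * r)%N by rewrite card_prod !card_ord.
pose k := (n %/ p)%N.
have k0 : (0 < k)%N by rewrite divn_gt0.
have many : (2 ^ k <= num_shattered a S)%N.
  apply: (@num_shattered_ge _ _ _ _ q) => //.
  rewrite -(ltr_nat R); apply: lt_le_trans bigS.
  apply: lt_le_trans (_ : (1 + x) ^+ (4 * r * n) <= _); last first.
    by rewrite exprM lerXn2r ?nnegrE ?exprn_ge0 ?addr_ge0 // ltW.
  (* Exponent budget: [r * n] for [(2 * q) ^ k], [r * n] for the factor [2], and [2 * #|Z|] for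
     [num_small]. *)
  rewrite (_ : 4 * r * n = r * n + (r * n + 2 * #|Z|))%N; last by rewrite cZ; lia.
  rewrite exprD (exprD _ (r * n)) !natrM natrX.
  have S0 : 0 < (num_small Z (#|Z| %/ q))%:R :> R.
    by rewrite ltr0n; apply/card_gt0P; exists set0; rewrite inE cards0.
  have hB : (num_small Z (#|Z| %/ q))%:R <= (1 + x) ^+ (2 * #|Z|).
    by apply: small; exact: leq_trunc_div.
  have hq : (2 * q)%:R ^+ k <= (1 + x) ^+ (r * n).
    apply: le_trans (_ : (1 + x) ^+ (p * k) <= _).
      by rewrite exprM lerXn2r ?nnegrE ?exprn_ge0 ?addr_ge0 // ltW.
    rewrite ler_weXn2l ?ltW ?gt1 // mulnC.
    by apply: leq_trans (leq_trunc_div _ _) _; rewrite leq_pmull.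
  have h2 : 2 < (1 + x) ^+ (r * n).
    apply: le_lt_trans (_ : (2 * q)%:R < _); first by rewrite ler_nat leq_pmulr.
    apply: lt_le_trans qp _; rewrite ler_weXn2l ?ltW ?gt1 //.
    by apply: leq_trans pn _; rewrite leq_pmull.
  apply: le_lt_trans (_ : (1 + x) ^+ (r * n) * (2 * (num_small Z (#|Z| %/ q))%:R) < _).
    by apply: ler_wpM2r => //; rewrite mulr_ge0 // ltW.
  rewrite ltr_pM2l ?exprn_gt0 ?addr_gt0 //.
  apply: lt_le_trans (_ : (1 + x) ^+ (r * n) * (num_small Z (#|Z| %/ q))%:R <= _).
    by rewrite ltr_pM2r.
  by apply: ler_wpM2l hB; rewrite exprn_ge0 ?addr_ge0 // ltW.
have few : (num_small Z (#|Z| %/ q') < 2 ^ k)%N.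
  rewrite -(ltr_nat R) natrX; apply: le_lt_trans (small' _ _ (leq_trunc_div _ _)) _.
  apply: lt_le_trans (_ : (1 + y) ^+ (4 * r * p * k) <= _); last first.
    by rewrite exprM lerXn2r ?nnegrE ?exprn_ge0 ?addr_ge0 // ltW.
  rewrite ltr_eXn2l ?gt1 // cZ.
  have np : (n < p * k.+1)%N by rewrite mulnC -ltn_divLR.
  have {}np : (n < 2 * (p * k))%N.
    by apply: leq_trans np _; rewrite mulnCA leq_mul2l; lia.
  rewrite (_ : 4 * r * p * k = 2 * (2 * (p * k) * r))%N; last by lia.
  by rewrite ltn_pmul2l // ltn_pmul2r.
have [W shW bigW] : exists2 W : {set Z}, shatters a S W & (#|Z| %/ q' < #|W|)%N.
  apply/exists_inP; apply: contraTT (leq_trans few many) => /exists_inPn h.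
  rewrite -leqNgt; apply/subset_leq_card/subsetP => W; rewrite !inE => /h.
  by rewrite -leqNgt.
pose J j := [set k' : 'I_n | (k', j) \in W].
have cW : (#|W| = \sum_j #|J j|)%N.
  rewrite -sum1_card (eq_bigr (fun j => \sum_(k' | (k', j) \in W) 1)%N); last first.
    by move=> j _; rewrite -sum1_card; apply: eq_bigl => k'; rewrite inE.
  rewrite (exchange_big_dep xpredT) //= pair_big_dep /=.
  by apply: eq_bigl => -[].
have [j hj] : exists j, (n <= q' * #|J j|)%N.
  apply/existsP; apply: contraTT bigW => /existsPn h.
  rewrite -leqNgt leq_divRL // mulnC cW big_distrr /= cZ.
  rewrite mulnC -[X in (_ <= X * _)%N](card_ord r) -sum_nat_const.
  by apply: leq_sum => j _; apply: ltnW; rewrite ltnNge h.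
exists j, (J j); split=> // V.
have [i iS hi] := shattersP _ _ _ shW [set z : Z | z.1 \in V].
by exists i => // k'; rewrite inE => /hi ->; rewrite inE.
Qed.

(* Otherwise every point starts an interval of length at most [m] on which [J]
   has density below [1 / (2q)], and such intervals tile [0, n). *)
Lemma exists_leader (J : pred nat) (q n m : nat) :
  (n <= q * count J (iota 0 n))%N -> (2 * q * m < n)%N ->
  exists k, forall L, (L <= m)%N -> (L <= 2 * q * count J (iota k L))%N.
Proof.
move=> dense mn.
case: (boolP [exists k : 'I_n, forall L : 'I_m.+1,
    (L <= 2 * q * count J (iota k L))%N]).
  by move=> /existsP[k /forallP h]; exists k => L; rewrite -ltnS => Lm;
     exact: (h (Ordinal Lm)).
move=> /existsPn h.
have tile t : forall a, (a + t = n)%N ->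
    (2 * q * count J (iota a t) <= t + 2 * q * m)%N.
  have [u] := ubnP t; elim: u t => // u IH t tu a atn.
  (* A final piece of length at most [m] is counted in full, whence the error [2 * q * m]. This
     error is below [n], so the bound for [t = n] contradicts [dense]. *)
  case: (leqP t m) => tm.
    rewrite (leq_trans _ (leq_addl _ _)) // leq_mul2l; apply/orP; right.
    by apply: leq_trans (count_size _ _) _; rewrite size_iota.
  have an : (a < n)%N by lia.
  have /forallPn[L] := h (Ordinal an); rewrite -ltnNge /= => hL.
  have Lm : (L <= m)%N by rewrite -ltnS.
  have L0 : (0 < L)%N by case: (nat_of_ord L) hL => //; rewrite muln0.
  rewrite (_ : t = L + (t - L))%N; last by lia.
  rewrite iotaD count_cat mulnDr.
  have := IH (t - L)%N _ (a + L)%N; move=> /(_ ltac:(lia) ltac:(lia)).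
  lia.
have := tile n 0%N erefl; lia.
Qed.

(* Imported only here: the set notions of classical_sets shadow those of finset. *)
From mathcomp Require Import all_classical all_reals all_analysis.
Local Open Scope classical_set_scope.

(** * Independent sets of times and the Frechet property *)

Lemma alternating_coloring (j : nat -> nat) :
  (forall m, exists n, (m <= j n)%N) ->
  exists s : pred nat, forall N b, exists2 n, (N <= n)%N & s (j n) = b.
Proof.
move=> unbd; pose I i := `[< exists n, j n = i >].
(* Parity of the number of smaller values of [j]: consecutive values get opposite colours. *)
pose s i := odd (count I (iota 0 i)); exists s => N b.
have next m : exists2 i, I i & (m <= i)%N.
  by have [n mn] := unbd m; exists (j n) => //; apply/asboolP; exists n.
(* Beyond all [j n] with [n < N], so values from [m] on are only attained at indices at least
   [N]. *)
pose m := (\max_(n < N) j n).+1.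
have late i : I i -> (m <= i)%N -> exists2 n, (N <= n)%N & j n = i.
  move=> /asboolP[n <-] mn; exists n => //; rewrite leqNgt; apply/negP => nN.
  by move: mn; rewrite ltnNge (leq_bigmax (Ordinal nN)).
have [i Ii mi] := next m.
have ex : exists i', I i' && (i < i')%N.
  by have [i' Ii' ii'] := next i.+1; exists i'; rewrite Ii'.
case: (ex_minnP ex) => i' /andP[Ii' ii'] mini'.
have si' : s i' = ~~ s i.
  rewrite /s (_ : i' = i + (1 + (i' - i.+1)))%N; last by lia.
  rewrite iotaD iotaD !count_cat /= Ii add0n addn0.
  rewrite (_ : count _ (iota (i + 1) _) = 0%N) ?addn0 ?addn1 //.
  apply/eqP; rewrite -leqn0 leqNgt -has_count; apply/hasPn => k.
  rewrite mem_iota => /andP[ik ki']; apply/negP => Ik.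
  by have := mini' k; rewrite Ik /=; lia.
have [n Nn jn] := late i Ii mi.
have [n' Nn' jn'] := late i' Ii' (leq_trans mi (ltnW ii')).
case: (altP (s i =P b)) => sib; first by exists n => //; rewrite jn.
by exists n' => //; rewrite jn' si'; case: b sib; case: (s i).
Qed.

Lemma closed_frequent (Y : topologicalType) (C : set Y) (u : nat -> Y) (y : Y) :
  closed C -> u @ \oo --> y ->
  (forall N, exists2 n, (N <= n)%N & C (u n)) -> C y.
Proof.
move=> Ccl uy freq; apply: Ccl => B /uy /= [N _ hN].
by have [n Nn Cun] := freq N; exists (u n); split=> //; exact: hN.
Qed.

Section Independence.
Context {R : realType} {X : metricType R}.
Implicit Types (T : X -> X) (A : bool -> set X) (J : pred nat).

Definition realizes T A J (s : pred nat) (x : X) : Prop :=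
  forall j, J j -> A (s j) (iter j T x).

Lemma iter_continuous T n : continuous T -> continuous (iter n T).
Proof.
move=> cT; elim: n => [|n IH] x; first exact: cvg_id.
by apply: (@continuous_comp _ _ _ (iter n T) T); [exact: IH | exact: cT].
Qed.

(** Every initial segment of [J] agrees with that of some [F m] with [m] arbitrarily large, so the
    density bounds pass to [J]. Points realizing [s] up to time [L] cluster, as [L] grows, at a
    point realizing all of [s], the sets [A b] being closed. *)
Lemma limit_independent_set T A (Q : nat) :
  compact [set: X] -> continuous T -> (forall b, closed (A b)) ->
  (forall m, exists J,
     (forall L, (L <= m)%N -> (L <= Q * count J (iota 0 L))%N) /\
     forall s, exists x, realizes T A J s x) ->
  exists J, (forall L, (L <= Q * count J (iota 0 L))%N) /\
     forall s, exists x, realizes T A J s x.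
Proof.
move=> cX cT Acl /choice[F hF].
(* The ultrafilter replaces a diagonal extraction of a convergent subsequence of the sets [F m]. *)
have [U [Uultra Uinf]] := @ultraFilterLemma _ (\oo : set_system nat) _.
pose J i := `[< U [set m | F m i] >].
have agree L : U [set m | forall i, (i < L)%N -> F m i = J i].
  elim: L => [|L IH]; first by apply: filterS filterT => m _ i.
  have UL : U [set m | F m L = J L].
    have [h|h] := in_ultra_setVsetC [set m | F m L] Uultra.
      by apply: filterS (h) => m /= ->; apply/esym/asboolP.
    apply: filterS (h) => m /= /negP/negbTE ->; apply/esym/asboolPn => h'.
    by have [k [nFk Fk]] := filter_ex (filterI h h'); exact: nFk.
  apply: filterS2 IH UL => m /= h hL i; rewrite ltnS leq_eqVlt.
  by case/orP => [/eqP->//|]; exact: h.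
have large L : exists2 m, (L <= m)%N & forall i, (i < L)%N -> F m i = J i.
  have UL : U [set m | (L <= m)%N] by apply: Uinf; exact: nbhs_infty_ge.
  by have [m [/= ? ?]] := filter_ex (filterI UL (agree L)); exists m.
exists J; split=> [L|s].
  have [m Lm hm] := large L; have [/(_ L Lm) + _] := hF m.
  rewrite (@eq_in_count _ (F m) J) // => i; rewrite mem_iota add0n => /andP[_].
  exact: hm.
have partial L : exists x, forall j, (j < L)%N -> J j -> A (s j) (iter j T x).
  have [m Lm hm] := large L; have [_ /(_ s)[x hx]] := hF m.
  by exists x => j jL Jj; apply: hx; rewrite hm.
have [x hx] := choice partial.
have [y [_ hy]] := cX (x @ \oo) _ filterT.
exists y => j Jj.
have cl : closed (iter j T @^-1` A (s j)).
  by apply: closed_comp (Acl _) => z _; exact: iter_continuous.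
apply: cl; move: hy; rewrite clusterE; apply.
by exists j.+1 => // L /= jL; apply: hx.
Qed.

Lemma frechet_not_independent T Ti A J :
  compact [set: X] -> (forall b, closed (A b)) ->
  A false `&` A true = set0 ->
  (forall m, exists2 j, J j & (m <= j)%N) ->
  (forall s, exists x, realizes T A J s x) ->
  ~ frechet_subspace (enveloping_semigroup T Ti).
Proof.
move=> cX Acl Adis infJ indJ frechet.
have disj y : A false y -> A true y -> False.
  by move=> ? ?; have : (A false `&` A true) y by []; rewrite Adis.
pose pw (j : nat) : {ptws X -> X} := iter j T.
pose tail m := [set pw j | j in [set j | J j /\ (m <= j)%N]].
(* Since [m <= e m], a cluster point of the [pw (e m)] lies in the closure of every tail. *)
have /choice[e he] : forall m, exists j, J j /\ (m <= j)%N.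
  by move=> m; have [j] := infJ m; exists j.
have cE : compact [set: {ptws X -> X}].
  have := @tychonoff X (fun=> X) (fun=> setT) (fun=> cX).
  by congr compact; apply/seteqP.
have [p [_ hp]] := cE ((pw \o e) @ \oo) _ filterT.
have ptail m : closure (tail m) p.
  move: hp; rewrite clusterE; apply; exists m => // n /= mn.
  have [Jn en] := he n; exists (e n) => //; split=> //; exact: leq_trans en.
have evcl x b : closed [set g : {ptws X -> X} | A b (g x)].
  apply: (@closed_comp _ _ (proj x : {ptws X -> X} -> X) (A b)) => // g _.
  exact: proj_continuous.
have tailE : tail 0%N `<=` range (fun n : int => (zpow T Ti n : {ptws X -> X})).
  by move=> _ [j _ <-]; exists (Posz j).
have [||u [hu up]] := frechet (tail 0%N) _ p _ (ptail 0%N%N).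
- by apply: subset_trans tailE _; exact: subset_closure.
- exact: closure_subset tailE _ (ptail 0%N%N).
have /choice[j hj] : forall n, exists j, J j /\ pw j = u n.
  by move=> n; have [j [Jj _] <-] := hu n; exists j.
have frequent s x b : realizes T A J s x ->
    (forall N, exists2 n, (N <= n)%N & s (j n) = b) -> A b (p x).
  move=> hx freq; apply: (@closed_frequent _ _ u p (evcl x b) up) => N.
  have [n Nn <-] := freq N; exists n => //=.
  by have [Jj <-] := hj n; exact: hx.
have [unbd|bd] := pselect (forall m, exists n, (m <= j n)%N).
  have [s hs] := alternating_coloring unbd; have [x hx] := indJ s.
  by apply: (disj (p x)); apply: (frequent _ _ _ hx) => N; exact: hs.
have [m hm] : exists m, forall n, (j n < m)%N.
  apply: contrapT => h; apply: bd => m; apply: contrapT => h'; apply: h.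
  by exists m => n; rewrite ltnNge; apply/negP => mn; apply: h'; exists n.
(* This colours every [j n] with [true] and every time in [tail m] with [false]. *)
have [x hx] := indJ (fun i => i < m)%N.
apply: (disj (p x)); last first.
  by apply: (frequent _ _ _ hx) => N; exists N => //=; exact: hm.
have sub : tail m `<=` [set g : {ptws X -> X} | A false (g x)].
  by move=> _ [i [Ji mi] <-] /=; have := hx i Ji; rewrite ltnNge mi.
exact/evcl/(closure_subset sub)/ptail.
Qed.

End Independence.

(** * From separated orbits to an independent set of times *)

Section SeparatedSets.
Context {R : realType} {X : metricType R}.
Implicit Types (T : X -> X).

Lemma finite_net (e : R) : compact [set: X] -> 0 < e ->
  exists s : seq X, forall x, exists2 p, p \in s & mdist p x < e.
Proof.
move=> cX e0.
have [[x0 _]|/asboolPn/forallp_asboolPn noX]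
  := pselect (exists x : X, True); last first.
  by exists [::] => x; case: (noX x).
pose Xp : ptopologicalType := HB.pack X (isPointed.Build X x0).
have : @compact Xp setT by [].
rewrite compact_cover.
move=> /(_ X setT (fun p => (ball p e)°)) [p _||s _ cov].
- exact: open_interior.
- by move=> x _; exists x => //; exact: nbhsx_ballx.
exists (finmap.enum_fset s) => x; have [p ps /interior_subset] := cov x Logic.I.
by rewrite ballEmdist => px; exists p.
Qed.

(* Two points at distance more than [e] are told apart by these sets as soon as
   [p] is at distance less than [e / 4] of one of them. *)
Definition near_far (p : X) (e : R) (b : bool) : set X :=
  if b then [set y | 3 / 4 * e <= mdist p y] else [set y | mdist p y <= e / 4].

Lemma near_far_closed p e b : closed (near_far p e b).
Proof.
case: b => y ycl /=; rewrite leNgt; apply/negP => hy.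
  have [z [/= hz]] := ycl _ (@nbhsx_ballx _ X y
    (3 / 4 * e - mdist p y) ltac:(by rewrite subr_gt0)).
  by rewrite ballEmdist /=; have := metric_triangle p y z; lra.
have [z [/= hz]] := ycl _ (@nbhsx_ballx _ X y
  (mdist p y - e / 4) ltac:(by rewrite subr_gt0)).
by rewrite ballEmdist /=; have := metric_triangle p z y; rewrite (metric_sym z y); lra.
Qed.

Lemma near_far_disjoint p e : 0 < e ->
  near_far p e false `&` near_far p e true = set0.
Proof.
by move=> e0; apply/seteqP; split=> // y [/= h h']; exfalso; lra.
Qed.

Definition itinerary T (n r : nat) (e : R) (p : 'I_r -> X) (x : X)
    (z : 'I_n * 'I_r) : option bool :=
  let d := mdist (p z.2) (iter z.1 T x) in
  if d <= e / 4 then Some false else if 3 / 4 * e <= d then Some true else None.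

Lemma itineraryP T n r e (p : 'I_r -> X) x (z : 'I_n * 'I_r) b :
  itinerary T e p x z = Some b -> near_far (p z.2) e b (iter z.1 T x).
Proof.
rewrite /itinerary; case: ifPn => h; first by case=> <-.
by case: ifPn => // h' [<-].
Qed.

(** At a time when the two orbits are more than [e] apart, a net point within [e / 4] of one is at
    least [3 / 4 * e] from the other. *)
Lemma itinerary_separated T n r e (p : 'I_r -> X) (s : seq X) : 0 < e ->
  (forall x, exists l, mdist (p l) x < e / 4) -> separated_seq T n e s ->
  pairwise_separated
    (fun i : 'I_(size s) => @itinerary T n r e p (tnth (in_tuple s) i))
    finset.setT.
Proof.
move=> e0 net [us sep] i j _ _ ij.
set x := tnth _ i; set y := tnth _ j.
have xy : x != y.
  rewrite /x /y !(tnth_nth x) /= nth_uniq //.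
have := sep x y (mem_tnth _ _) (mem_tnth _ _) xy.
rewrite /bowen_dist => big.
have [k hk] : exists k : 'I_n, e < mdist (iter k T x) (iter k T y).
  apply: contrapT => h; move: big; rewrite ltNge => /negP; apply.
  apply: bigmax_le => [|k _]; first exact: ltW.
  by rewrite leNgt; apply/negP => hk; apply: h; exists k.
have [l hl] := net (iter k T x).
exists (k, l), false; rewrite /itinerary /=.
have := metric_triangle (iter k T x) (p l) (iter k T y).
rewrite (metric_sym _ (p l)) => tri.
rewrite ifT; last exact: ltW.
by rewrite ifF ?ifT //; [lra|apply/negbTE; rewrite -ltNge; lra].
Qed.

Lemma independent_of_growth T (e c : R) : compact [set: X] -> continuous T ->
  0 < e -> 0 < c ->
  (forall n0, exists2 n, (n0 <= n)%N &
     exists2 s, separated_seq T n e s & (1 + c) ^+ n <= (size s)%:R) ->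
  exists (A : bool -> set X) (J : pred nat),
  [/\ forall b, closed (A b), A false `&` A true = set0,
    forall m, exists2 j, J j & (m <= j)%N
    & forall s, exists x, realizes T A J s x].
Proof.
move=> cX cT e0 c0 growth.
have [t net] := @finite_net (e / 4) cX ltac:(by rewrite divr_gt0).
pose r := size t.
pose p (l : 'I_r) : X := tnth (in_tuple t) l.
have pnet x : exists l, mdist (p l) x < e / 4.
  have [y yt yx] := net x; have /tnthP[l yl] : y \in in_tuple t by [].
  by exists l; rewrite /p -yl.
have r0 : (0 < r)%N.
  have [n _ [s _ hs]] := growth 0%N.
  have : 0 < (size s)%:R :> R by apply: lt_le_trans hs; rewrite exprn_gt0 // addr_gt0.
  case: s {hs} => [|x s _]; first by rewrite ltxx.
  by have [l _] := pnet x; exact: leq_ltn_trans (ltn_ord l).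
have [q [n0 [q0 shat]]] := @exists_linear_shattered R c r c0 r0.
pose good l n := exists J : pred nat, (n <= q * count J (iota 0 n))%N /\
  forall s, exists x, realizes T (near_far (p l) e) J s x.
have ex_good n1 : exists2 n, (n1 <= n)%N & exists l, good l n.
  have [n hn [s sep hs]] := growth (maxn n0 n1).
  exists n; first exact: leq_trans (leq_maxr _ _) hn.
  have := shat n _ _ _ (leq_trans (leq_maxl _ _) hn) (itinerary_separated e0 pnet sep).
  rewrite cardsT card_ord => /(_ hs)[l [J [cJ hJ]]].
  exists l, (fun k => [exists i in J, (i : nat) == k]); split.
    apply: leq_trans cJ _; rewrite leq_mul2l; apply/orP; right.
    rewrite -(val_enum_ord n) count_map.
    have -> : #|J| = count (mem J) (enum 'I_n) by rewrite cardE enumT -size_filter.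
    by apply: sub_count => i iJ /=; apply/exists_inP; exists i.
  move=> w; have [i _ hi] := hJ (finset (fun k : 'I_n => w k)).
  exists (tnth (in_tuple s) i) => _ /exists_inP[k kJ /eqP<-].
  by have /itineraryP := hi k kJ; rewrite inE.
(* The net point [l] depends on [n]; by pigeonhole, one of them serves infinitely many [n]. *)
have [l hl] : exists l, forall n1, exists2 n, (n1 <= n)%N & good l n.
  apply: contrapT => h.
  have /choice[N hN] : forall l, exists N, forall n, (N <= n)%N -> ~ good l n.
    move=> l; apply: contrapT => h'; apply: h; exists l => n1.
    apply: contrapT => h''; apply: h'; exists n1 => n n1n gd; apply: h''.
    by exists n.
  have [n hn [l gd]] := ex_good (\max_l N l); apply: (hN l n) gd.
  exact: leq_trans (leq_bigmax l) hn.
have [||||J [densJ realJ]] := @limit_independent_set R X T (near_far (p l) e) (2 * q).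
- exact: cX.
- exact: cT.
- by move=> b; exact: near_far_closed.
- move=> m; have [n hn [J [dens real]]] := hl (2 * q * m).+1.
  have [k hk] := exists_leader dens hn.
  exists (fun i => J (k + i)%N); split=> [L /hk|s].
    by rewrite -[in iota k L](addn0 k) iotaDl count_map.
  (* Times are shifted to start at [k]: the colouring is moved forward by [k], and [iter k T x] then
     realizes [s]. *)
  have [x hx] := real (fun i => s (i - k)%N).
  exists (iter k T x) => i Ji; rewrite -iterD addnC.
  by have := hx _ Ji; rewrite addKn.
exists (near_far (p l) e), J; split=> //.
- by move=> b; exact: near_far_closed.
- exact: near_far_disjoint.
(* If [J] lay below [m], its counts would be at most [m], contradicting the density bound at length
   [m + (2 * q * m).+1]. *)
- move=> m; apply: contrapT => h.
  have none t' : count J (iota m t') = 0%N.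
    apply/eqP; rewrite -leqn0 leqNgt -has_count; apply/hasPn => j.
    rewrite mem_iota => /andP[mj _]; apply/negP => Jj; apply: h.
    by exists j.
  have := densJ (m + (2 * q * m).+1)%N; rewrite iotaD count_cat none addn0.
  have := count_size J (iota 0 m); rewrite size_iota.
  by move: (count J _) => k; nia.
Qed.

End SeparatedSets.

(** * Growth rates and the vanishing of the entropy *)

Section Entropy.
Context {R : realType} {X : metricType R}.
Implicit Types (T : X -> X).
Local Open Scope ereal_scope.

Lemma sep_num_ge T n e (s : seq X) : separated_seq T n e s ->
  (size s)%:R%:E <= sep_num T n e.
Proof.
move=> hs; apply: le_ereal_sup_tmp.
by exists (size s)%:R%:E => //; exists s.
Qed.

Lemma sep_num_ge0 T n e : 0 <= sep_num T n e.
Proof. by have := @sep_num_ge T n e [::]; apply; split. Qed.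

Definition sep_rate T (e : R) (n : nat) : \bar R :=
  match sep_num T n e with
  | EFin r => (ln r / n%:R)%:E
  | _ => +oo
  end.

Lemma sep_rate_ge0 T e n : 0 <= sep_rate T e n.
Proof.
rewrite /sep_rate; case E : (sep_num T n e) => [r| |] //; rewrite lee_fin.
rewrite divr_ge0 //.
have [r1|r1] := leP 1%R r; first by rewrite ln_ge0.
(* [ln] is [0] at nonpositive reals, and a supremum of integer sizes is never strictly between [0]
   and [1]. *)
rewrite ln0 // leNgt; apply/negP => r0.
have : 0 < sep_num T n e by rewrite E lte_fin.
move=> /ereal_sup_gt[_ [s hs <-]].
rewrite lte_fin ltr0n => s0.
have := sep_num_ge hs; rewrite E lee_fin => /le_lt_trans/(_ r1).
by rewrite ltrn1 => /eqP; case: (size s) s0.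
Qed.

(** A finite supremum exceeds [expR (c * n%:R)], which is at least [(1 + c) ^+ n] because
    [1 + c <= expR c]; some actual family then does as well. *)
Lemma separated_of_sep_rate T e c n : (0 < c)%R -> c%:E < sep_rate T e n ->
  exists2 s, separated_seq T n e s & ((1 + c) ^+ n <= (size s)%:R)%R.
Proof.
move=> c0 hc.
suff : ((1 + c) ^+ n)%:E < sep_num T n e.
  by move=> /ereal_sup_gt[_ [s hs <-]]; rewrite lte_fin => /ltW hn; exists s.
move: hc; rewrite /sep_rate; have := sep_num_ge0 T n e.
case: (sep_num T n e) => [r _|_ _|]; [|by rewrite ltry|by rewrite leeNy_eq].
(* At [n = 0] division by zero makes the rate [0], which [0 < c] excludes. *)
rewrite !lte_fin; case: n => [|n]; first by rewrite invr0 mulr0 ltNge ltW.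
rewrite ltr_pdivlMr ?ltr0n // => hc.
have r0 : (0 < r)%R.
  rewrite ltNge; apply/negP => r0; move: hc; rewrite ln0 //.
  by rewrite ltNge mulr_ge0 // ltW.
apply: le_lt_trans (_ : expR (c * n.+1%:R) < r)%R; last first.
  by rewrite -[ltRHS]lnK ?posrE // ltr_expR.
rewrite expRM_natr; apply: lerXn2r; rewrite ?nnegrE ?expR_ge0 ?expR_ge1Dx //.
by rewrite addr_ge0 // ltW.
Qed.

End Entropy.

Theorem mainTheorem5 (R : realType) (X : metricType R) (T Ti : X -> X) :
  compact [set: X] ->
  is_homeomorphism T Ti ->
  minimal_system T Ti ->
  tame_system T Ti ->
  topological_entropy T = 0%E.
Proof.
move=> cX [_ _ cT _] _ [_ frechet].
have growthE e : sep_growth T e = limn_esup (sep_rate T e) by [].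
apply/eqP; rewrite eq_le; apply/andP; split.
  apply: ge_ereal_sup => _ [e /= e0 <-]; rewrite growthE.
  apply/lee_addgt0Pr => c c0; rewrite add0e.
  (* Either the rate is eventually at most [c], which bounds the upper limit, or it exceeds [c] for
     arbitrarily large [n], which yields an independent set. *)
  have [[N hN]|unbd] := pselect (exists N, forall n, (N <= n)%N ->
      (sep_rate T e n <= c%:E)%E).
    apply: ge_ereal_inf; exists (ereal_sup (sep_rate T e @` [set n | (N <= n)%N])).
      by exists [set n | (N <= n)%N] => //; exact: nbhs_infty_ge.
    by apply: ge_ereal_sup => _ [n /= Nn <-]; exact: hN.
  exfalso.
  have [|A [J [Acl Adis infJ indJ]]] := independent_of_growth cX cT e0 c0.
    move=> N; apply: contrapT => h; apply: unbd; exists N => n Nn.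
    rewrite leNgt; apply/negP => /(separated_of_sep_rate c0) hs.
    by apply: h; exists n.
  exact: frechet_not_independent cX Acl Adis infJ indJ frechet.
apply: le_ereal_sup_tmp; exists (sep_growth T 1); first by exists 1 => //=.
rewrite growthE; apply: le_ereal_inf_tmp => _ [V [N _ hV] <-].
apply: le_ereal_sup_tmp; exists (sep_rate T 1 N); last exact: sep_rate_ge0.
by exists N => //; apply: hV => /=.
Qed.
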